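(* Let $R$ be a reduced commutative ring in which $2$ is a unit. (a) Every nonzero proper ideal of $R$ is an sdf-absorbing ideal of $R$ if and only if $R$ is a field or $R$ is isomorphic to $F_1 \times F_2$ for some fields $F_1, F_2$. (b) Every proper ideal of $R$ is an sdf-absorbing ideal of $R$ if and only if $R$ is a field.
   Context: All rings are commutative with identity $1 \neq 0$. A proper ideal $I$ of a commutative ring $R$ is a square-difference factor absorbing ideal (sdf-absorbing ideal) of $R$ if whenever $a, b \in R$ are both nonzero and $a^2 - b^2 \in I$, then $a + b \in I$ or $a - b \in I$. A ring is reduced if it has no nonzero nilpotent elements. *)

(* Defs.v *)
From HB Require Import structures.
From mathcomp Require Import all_boot all_order all_algebra.

Set Implicit Arguments.
Unset Strict Implicit.
Unset Printing Implicit Defensive.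

Import GRing.Theory.
Local Open Scope ring_scope.

Definition nilpotent_elt (R : comNzRingType) (x : R) : Prop :=
  exists n : nat, x ^+ n = 0.

Definition reduced_ring (R : comNzRingType) : Prop :=
  forall x : R, nilpotent_elt x -> x = 0.

(* In MathComp, [idealr_closed I] says that I is a *proper* ideal: it contains
   the clause [1 \notin I].  Ideals are boolean predicates, as in the library;
   classically these are all the subsets of R. *)
Definition sdf_absorbing (R : comNzRingType) (I : {pred R}) : Prop :=
  idealr_closed I /\
  (forall a b : R, a != 0 -> b != 0 -> a ^+ 2 - b ^+ 2 \in I ->
     a + b \in I \/ a - b \in I).

Definition nonzero_ideal (R : comNzRingType) (I : {pred R}) : Prop :=
  exists2 x : R, x \in I & x != 0.

Definition ring_isomorphic (R S : comNzRingType) : Prop :=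
  exists f : {rmorphism R -> S}, bijective f.

(* Main.v *)
Require Import Defs.
From HB Require Import structures.
From mathcomp Require Import all_boot all_order all_algebra.
From mathcomp Require Import boolp ring.
Import GRing.Theory.
Local Open Scope ring_scope.

(** Since 2 is a unit, the substitution x = a + b, y = a - b turns the
    sdf-absorbing condition into the prime condition x y \in I -> x \in I or
    y \in I, tested only on pairs with x != y and x != - y.  On the excluded
    pairs the premise says that x ^ 2 \in I, and then a nonzero element i of I
    gives another pair, x and x + i, to which the condition applies; so a
    nonzero sdf-absorbing ideal is prime ([sdf_absorbing_prime]).

    Suppose that all nonzero proper ideals of the reduced ring R are prime and
    that x is neither 0 nor a unit.  Then (x ^ 2) is nonzero, proper, and prime,
    so x = x ^ 2 r for some r and e = x r is an idempotent other than 0 and 1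
    ([primes_idempotent]).  The same construction applied to a nonzero element
    y of e R yields an idempotent f below e with y R = f R; as f (e - f) = 0
    lies in the prime ideal (1 - e), which meets e R only in 0, and f != 0, it
    follows that f = e and y is invertible in e R.  Thus e R and (1 - e) R are
    fields ([corner_inverse], [corner_field]) and R is their product.

    Conversely, the nonzero proper ideals of F1 * F2 are the two kernels of the
    projections, and the kernel of a morphism to a field is sdf-absorbing since
    a ^ 2 - b ^ 2 = (a - b) (a + b).  In a field 0 is such a kernel too, whereas
    0 is not sdf-absorbing in the presence of a nontrivial idempotent e: take
    a = 1 and b = 2 e - 1, which have equal squares ([sdf0_idempotent]). *)

(** * Ideals *)

Section Ideals.

Variables (R : comNzRingType) (I : {pred R}).
Hypothesis idI : idealr_closed I.

Lemma ideal_mulr a u : u \in I -> u * a \in I.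
Proof. by case: idI => I0 _ h uI; rewrite mulrC -[_ * _]addr0; apply: h. Qed.

Lemma ideal_add u v : u \in I -> v \in I -> u + v \in I.
Proof. by case: idI => I0 _ h uI vI; rewrite -[u]mul1r; apply: h. Qed.

Lemma ideal_sub u v : u \in I -> v \in I -> u - v \in I.
Proof.
by move=> uI vI; apply: ideal_add => //; rewrite -mulrN1; apply: ideal_mulr.
Qed.

End Ideals.

Definition principal_ideal {R : comNzRingType} (x : R) : {pred R} :=
  [pred y | `[< exists r, y = x * r >]].

Lemma principal_idealP (R : comNzRingType) (x y : R) :
  reflect (exists r, y = x * r) (y \in principal_ideal x).
Proof. exact: asboolP. Qed.

Lemma mem_principal_ideal (R : comNzRingType) (x : R) :
  x \in principal_ideal x.
Proof. by apply/principal_idealP; exists 1; rewrite mulr1. Qed.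

Lemma principal_ideal_closed (R : comNzRingType) (x : R) :
  ~ (exists r, 1 = x * r) -> idealr_closed (principal_ideal x).
Proof.
move=> nu; split; first by apply/principal_idealP; exists 0; rewrite mulr0.
  by apply/principal_idealP.
move=> a u v /principal_idealP[r ->] /principal_idealP[s ->].
by apply/principal_idealP; exists (a * r + s); ring.
Qed.

(** * Sdf-absorbing ideals and prime ideals *)

(** The substitution is a = (x + y) / 2, b = (x - y) / 2. *)
Lemma sdf_absorbing_mul (R : comUnitRingType) (I : {pred R}) (x y : R) :
    (2%:R : R) \is a GRing.unit -> sdf_absorbing I ->
    x != y -> x != - y -> x * y \in I ->
  x \in I \/ y \in I.
Proof.
move=> u2 [idI sdfI] neq_xy neq_xNy xyI; set h : R := 2%:R^-1.
have h2 : 2%:R * h = 1 by rewrite divrr.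
have half_neq0 z : z != 0 -> h * z != 0.
  apply: contraNneq => hz0.
  by rewrite -[z]mul1r -h2 -mulrA hz0 mulr0.
have xE : x = h * (x + y) + h * (x - y) by rewrite -[LHS]mul1r -h2; ring.
have yE : y = h * (x + y) - h * (x - y) by rewrite -[LHS]mul1r -h2; ring.
suff: h * (x + y) + h * (x - y) \in I \/ h * (x + y) - h * (x - y) \in I.
  by rewrite -xE -yE.
apply: sdfI.
- by apply: half_neq0; rewrite addr_eq0.
- by apply: half_neq0; rewrite subr_eq0.
- by rewrite subr_sqr -xE -yE [y * x]mulrC.
Qed.

(** If x ^ 2 \in I, replace the pair (x, x) by (x, x + i) with i != 0 in I;
    these two differ, and if they are opposite then 2 x = - i \in I, whence
    x \in I already. *)
Lemma sdf_absorbing_semiprime (R : comUnitRingType) (I : {pred R}) (x : R) :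
    (2%:R : R) \is a GRing.unit -> sdf_absorbing I -> nonzero_ideal I ->
  x * x \in I -> x \in I.
Proof.
move=> u2 sdfI [i iI i0] xxI; have [idI _] := sdfI.
have [xE|neq_xN] := eqVneq x (- (x + i)).
  have -> : x = (0 - i) * 2%:R^-1.
    have -> : 0 - i = x * 2%:R by rewrite [in RHS]mulrDr mulr1 {2}xE; ring.
    by rewrite mulrK.
  by apply: ideal_mulr => //; apply: ideal_sub => //; case: idI.
have neq_x : x != x + i.
  by apply: contraNneq i0 => /(congr1 (fun z => z - x)) /eqP;
    rewrite subrr addrC addKr eq_sym.
have xI : x * (x + i) \in I.
  by rewrite mulrDr; apply: ideal_add => //; rewrite mulrC; apply: ideal_mulr.
have [//|xiI] := sdf_absorbing_mul _ _ _ _ u2 sdfI neq_x neq_xN xI.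
by rewrite -(addrK i x); apply: ideal_sub.
Qed.

Lemma sdf_absorbing_prime (R : comUnitRingType) (I : {pred R}) :
    (2%:R : R) \is a GRing.unit -> sdf_absorbing I -> nonzero_ideal I ->
  prime_idealr_closed I.
Proof.
move=> u2 sdfI nzI x y xyI; have [idI _] := sdfI; apply/orP.
have [xE|neq_xy] := eqVneq x y.
  by left; apply: sdf_absorbing_semiprime => //; rewrite {2}xE.
have [xE|neq_xNy] := eqVneq x (- y); last exact: sdf_absorbing_mul xyI.
left; apply: sdf_absorbing_semiprime => //.
by rewrite {2}xE mulrN -mulrN1; apply: ideal_mulr.
Qed.

Lemma kernel_sdf_absorbing (R : comNzRingType) (F : idomainType)
    (h : {rmorphism R -> F}) (I : {pred R}) :
  idealr_closed I -> (forall x, (x \in I) = (h x == 0)) -> sdf_absorbing I.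
Proof.
move=> idI kerI; split=> // a b _ _; rewrite subr_sqr !kerI rmorphM mulf_eq0.
by case/orP; [right | left].
Qed.

(** 1 and 2 e - 1 have equal squares, while their sum 2 e and their
    difference 2 (1 - e) vanish only for e = 0 and e = 1. *)
Lemma sdf0_idempotent (R : comUnitRingType) (e : R) :
    (2%:R : R) \is a GRing.unit -> sdf_absorbing (pred1 (0 : R)) ->
  e * e = e -> e = 0 \/ e = 1.
Proof.
move=> u2 [_ sdf0] ee; pose b := 2%:R * e - 1.
have bb : b * b = 1.
  have -> : b * b = 4%:R * (e * e) - 4%:R * e + 1 by rewrite /b; ring.
  by rewrite ee subrr add0r.
have b0 : b != 0.
  by apply: contraTneq (oner_neq0 R) => b0; rewrite -bb b0 mulr0 eqxx.
have sq0 : 1 ^+ 2 - b ^+ 2 \in pred1 (0 : R).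
  by rewrite expr1n expr2 bb subrr inE.
have [] := sdf0 1 b (oner_neq0 R) b0 sq0; rewrite inE => /eqP E0.
- by left; apply: (mulrI u2); rewrite mulr0 -E0 /b; ring.
- right; apply/eqP; rewrite eq_sym -subr_eq0; apply/eqP/(mulrI u2).
  by rewrite mulr0 -E0 /b; ring.
Qed.

(** * Reduced rings whose nonzero proper ideals are prime *)

Section Primes.

Variable R : comNzRingType.
Hypothesis R_reduced : reduced_ring R.
Hypothesis primes :
  forall I : {pred R},
    idealr_closed I -> nonzero_ideal I -> prime_idealr_closed I.

(** Unless x is 0 or invertible, the ideal (x ^ 2) is nonzero and proper, hence
    prime, and therefore contains x. *)
Lemma primes_regular (x : R) : exists r, x = x * x * r.
Proof.
have [->|x0] := eqVneq x 0; first by exists 0; rewrite !mulr0.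
have [[r xr]|nux] := pselect (exists r, 1 = x * r).
  by exists r; rewrite -mulrA -xr mulr1.
have id : idealr_closed (principal_ideal (x * x)).
  apply: principal_ideal_closed => -[r xxr].
  by apply: nux; exists (x * r); rewrite mulrA.
have nz : nonzero_ideal (principal_ideal (x * x)).
  exists (x * x); first exact: mem_principal_ideal.
  by apply: contra_neq x0 => xx0; apply: R_reduced; exists 2%N.
have /orP[] := primes _ id nz _ _ (mem_principal_ideal R (x * x));
  by move/principal_idealP.
Qed.

Lemma primes_idempotent (x : R) :
    x != 0 -> ~ (exists r, 1 = x * r) ->
  exists e : R, [/\ e * e = e, e != 0 & e != 1].
Proof.
move=> x0 nux; have [r xE] := primes_regular x; exists (x * r); split.
- by rewrite mulrACA mulrA -xE.
- by apply: contra_neq x0 => xr0; rewrite xE -mulrA xr0 mulr0.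
- by apply: contra_notN nux => /eqP xr1; exists r.
Qed.

(** With f = y r the idempotent generating y R, the product f (e - f) = 0 lies
    in the prime ideal (1 - e), whose elements are killed by e. *)
Lemma corner_inverse (e y : R) :
    e * e = e -> e != 0 -> e != 1 -> y * e = y -> y != 0 ->
  exists r, y * r = e.
Proof.
move=> ee e0 e1 ye y0; have [r yE] := primes_regular y.
have killed z : z \in principal_ideal (1 - e) -> z * e = 0.
  by case/principal_idealP=> s ->; rewrite mulrAC mulrBl mul1r ee subrr mul0r.
have id : idealr_closed (principal_ideal (1 - e)).
  apply: principal_ideal_closed => /principal_idealP /killed /eqP.
  by rewrite mul1r (negPf e0).
have nz : nonzero_ideal (principal_ideal (1 - e)).
  by exists (1 - e); [exact: mem_principal_ideal | rewrite subr_eq0 eq_sym].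
exists r; have fe : y * r * e = y * r by rewrite mulrAC ye.
have ff : y * r * (y * r) = y * r by rewrite mulrACA mulrA -yE.
have prod0 : y * r * (e - y * r) \in principal_ideal (1 - e).
  by rewrite mulrBr fe ff subrr; case: id.
have /orP[/killed f0|/killed /eqP] := primes _ id nz _ _ prod0.
  by case/eqP: y0; rewrite yE -mulrA -fe f0 mulr0.
by rewrite mulrBl ee fe subr_eq0 => /eqP.
Qed.

End Primes.

(** * The field e R *)

Section Corner.

Variables (R : comUnitRingType) (e : R).

Definition corner_pred : {pred R} := [pred x | x * e == x].

Lemma corner_zmod_closed : zmod_closed corner_pred.
Proof.
split; first by rewrite inE mul0r.
by move=> x y; rewrite !inE => /eqP xe /eqP ye; rewrite mulrBl xe ye.
Qed.

HB.instance Definition _ :=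
  GRing.isZmodClosed.Build R corner_pred corner_zmod_closed.

Record corner :=
  Corner { corner_val : R; corner_valP : corner_val \in corner_pred }.

HB.instance Definition _ := [isSub for corner_val].
HB.instance Definition _ := [Choice of corner by <:].
HB.instance Definition _ := [SubChoice_isSubZmodule of corner by <:].

Hypothesis ee : e * e = e.

Lemma corner_mul_subproof (x : R) : x * e \in corner_pred.
Proof. by rewrite inE -mulrA ee. Qed.

Definition corner_proj (x : R) : corner := Corner (x * e) (corner_mul_subproof x).

Lemma corner_val_mule (x : corner) : val x * e = val x.
Proof. by apply/eqP; have := valP x; rewrite inE. Qed.

(** The morphism from R is retained together with its section, because these
    are the data from which an isomorphism of R with a product is built. *)
Lemma corner_field :
    e != 0 -> (forall y, y * e = y -> y != 0 -> exists r, y * r = e) ->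
  exists (F : fieldType) (h : {rmorphism R -> F}) (s : F -> R),
    (forall x, s (h x) = x * e) /\ cancel s h.
Proof.
move=> e0 inve.
pose mul (x y : corner) := corner_proj (val x * val y).
(* y + (1 - e) is a unit of R when y != 0, and for y = 0 it is a non-unit
   fixed by the inverse of R, whence the value 0. *)
pose inv (x : corner) := corner_proj (val x + (1 - e))^-1.
have valM x y : val (mul x y) = val x * val y.
  by rewrite /= -mulrA corner_val_mule.
have mulA : associative mul.
  by move=> x y z; apply: val_inj; rewrite !valM mulrA.
have mulC : commutative mul.
  by move=> x y; apply: val_inj; rewrite !valM mulrC.
have mul1 : left_id (corner_proj 1) mul.
  by move=> x; apply: val_inj; rewrite valM /= mul1r mulrC corner_val_mule.
have mulD : left_distributive mul +%R.
  by move=> x y z; apply: val_inj; rewrite raddfD /= -!mulrDl.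
have one_neq0 : corner_proj 1 != 0.
  by rewrite -val_eqE /= mul1r.
pose Rmix := GRing.Zmodule_isComNzRing.Build corner mulA mulC mul1 mulD one_neq0.
pose K : comNzRingType := HB.pack corner Rmix.
have mulV (x : K) : x != 0 -> (inv x : K) * x = 1.
  rewrite -val_eqE => /= x0; have [r xr] := inve _ (corner_val_mule x) x0.
  apply: val_inj; rewrite valM /= mul1r.
  have xe : corner_val x * e = corner_val x := corner_val_mule x.
  move: xr; rewrite /=; set y := corner_val x in xe * => xr.
  have unit_y : (y + (1 - e)) * (r * e + (1 - e)) = 1.
    have -> : (y + (1 - e)) * (r * e + (1 - e)) =
              y * r * e + (y - y * e) + r * (e - e * e) + 1 + (e * e - e) - e.
      by ring.
    by rewrite xr xe ee !subrr mulr0 !addr0 addrAC subrr add0r.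
  have Uy : y + (1 - e) \is a GRing.unit.
    by apply/unitrPr; exists (r * e + (1 - e)).
  have ye : (y + (1 - e)) * e = y by rewrite mulrDl mulrBl mul1r ee subrr addr0.
  by rewrite -mulrA [e * y]mulrC xe -{2}ye mulKr.
have inv0 : inv (0 : K) = 0 :> K.
  apply: val_inj => /=; rewrite add0r invr_out ?mulrBl ?mul1r ?ee ?subrr //.
  apply: contra e0 => U; rewrite -(mulKr U e) mulrBl mul1r ee subrr.
  by rewrite mulr0.
pose Fmix := GRing.ComNzRing_isField.Build K mulV inv0.
pose F : fieldType := HB.pack K Fmix.
pose h (x : R) : F := corner_proj x.
have hB : zmod_morphism h.
  by move=> x y; apply: val_inj; rewrite raddfB /= mulrBl.
have hM : monoid_morphism h.
  by split=> // x y; apply: val_inj; rewrite valM /= mulrACA ee.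
pose hadd := GRing.isZmodMorphism.Build R F h hB.
pose hmul := GRing.isMonoidMorphism.Build R F h hM.
pose H : {rmorphism R -> F} := HB.pack h hadd hmul.
exists F, H, (fun x : F => corner_val x); split=> // x.
by apply: val_inj => /=; apply: corner_val_mule.
Qed.

End Corner.

(** Peirce decomposition R = e R * (1 - e) R. *)
Lemma idempotent_product (R : comUnitRingType) (e : R) :
    e * e = e -> e != 0 -> e != 1 ->
    (forall e' y : R, e' * e' = e' -> e' != 0 -> e' != 1 ->
       y * e' = y -> y != 0 -> exists r, y * r = e') ->
  exists F1 F2 : fieldType, ring_isomorphic R (F1 * F2)%type.
Proof.
move=> ee e0 e1 inve; set e' := 1 - e.
have e'e' : e' * e' = e'.
  by rewrite /e' mulrBl mul1r mulrBr mulr1 ee subrr subr0.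
have e'0 : e' != 0 by rewrite subr_eq0 eq_sym.
have e'1 : e' != 1 by rewrite -subr_eq0 /e' addrAC subrr add0r oppr_eq0.
have e_e' : e * e' = 0 by rewrite mulrBr mulr1 ee subrr.
have [F1 [h1 [s1 [s1h h1s]]]] :=
  corner_field R e ee e0 (fun y => inve e y ee e0 e1).
have [F2 [h2 [s2 [s2h h2s]]]] :=
  corner_field R e' e'e' e'0 (fun y => inve e' y e'e' e'0 e'1).
have h1s2 b : h1 (s2 b) = 0.
  rewrite -[LHS]h1s s1h -[b]h2s s2h -mulrA [e' * e]mulrC e_e' mulr0.
  exact: rmorph0.
have h2s1 a : h2 (s1 a) = 0.
  by rewrite -[LHS]h2s s2h -[a]h1s s1h -mulrA e_e' mulr0; exact: rmorph0.
exists F1, F2.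
pose f (x : R) : (F1 * F2)%type := (h1 x, h2 x).
have fB : zmod_morphism f by move=> x y; rewrite /f !rmorphB.
have fM : monoid_morphism f by split=> [|x y]; rewrite /f ?rmorph1 ?rmorphM.
pose fadd := GRing.isZmodMorphism.Build R (F1 * F2)%type f fB.
pose fmul := GRing.isMonoidMorphism.Build R (F1 * F2)%type f fM.
pose H : {rmorphism R -> (F1 * F2)%type} := HB.pack f fadd fmul.
exists H; exists (fun p => s1 p.1 + s2 p.2).
  by move=> x /=; rewrite s1h s2h -mulrDr addrC subrK mulr1.
by case=> a b; rewrite /= /f !rmorphD h1s h2s h1s2 h2s1 addr0 add0r.
Qed.

(** * Ideals of a product of two fields *)

(** A nonzero ideal contains (1, 0) or (0, 1), and not both if it is proper;
    if it contains (1, 0), it is the kernel of the second projection. *)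
Lemma product_ideal_kernel (R : comNzRingType) (F1 F2 : fieldType)
    (f : {rmorphism R -> (F1 * F2)%type}) (I : {pred R}) :
    bijective f -> idealr_closed I -> nonzero_ideal I ->
  (forall x, (x \in I) = ((f x).1 == 0)) \/
  (forall x, (x \in I) = ((f x).2 == 0)).
Proof.
case=> g gK fK idI [x xI x0].
have [_ I1 _] := idI.
have memI y z : y \in I -> (exists t, f z = f y * t) -> z \in I.
  move=> yI [t zE]; have -> : z = y * g t by apply: (can_inj gK); rewrite rmorphM fK.
  exact: ideal_mulr.
have e1I y : y \in I -> (f y).1 != 0 -> g (1, 0) \in I.
  move=> yI y1; apply: (memI y) => //; exists ((f y).1^-1, 0).
  by rewrite fK; congr (_, _) => /=; rewrite ?divff ?mulr0.
have e2I y : y \in I -> (f y).2 != 0 -> g (0, 1) \in I.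
  move=> yI y2; apply: (memI y) => //; exists (0, (f y).2^-1).
  by rewrite fK; congr (_, _) => /=; rewrite ?divff ?mulr0.
have not_both : g (1, 0) \in I -> g (0, 1) \in I -> False.
  move=> /(ideal_add _ _ idI) a /a; rewrite (_ : _ + _ = 1) ?(negPf I1) //.
  apply: (can_inj gK); rewrite rmorphD !fK rmorph1.
  by congr (_, _); rewrite /= ?addr0 ?add0r.
have : ((f x).1 != 0) || ((f x).2 != 0).
  rewrite -negb_and; apply: contra x0 => /andP[/eqP x1 /eqP x2].
  apply/eqP/(can_inj gK); rewrite rmorph0.
  by case: (f x) x1 x2 => a b /= -> ->.
case/orP=> [x1|x2]; [right|left] => y; apply/idP/idP.
- by move=> yI; apply: contraT => /(e2I _ yI) /(not_both (e1I _ xI x1)).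
- move/eqP=> y2; apply: (memI _ _ (e1I _ xI x1)); exists (f y).
  by rewrite fK; case: (f y) y2 => a b /= ->; congr (_, _); rewrite /= ?mul1r ?mul0r.
- move=> yI; apply: contraT => /(e1I _ yI) e1.
  by case: (not_both e1 (e2I _ xI x2)).
- move/eqP=> y1; apply: (memI _ _ (e2I _ xI x2)); exists (f y).
  by rewrite fK; case: (f y) y1 => a b /= ->; congr (_, _); rewrite /= ?mul1r ?mul0r.
Qed.

Lemma product_sdf_absorbing (R : comNzRingType) (F1 F2 : fieldType)
    (I : {pred R}) :
    ring_isomorphic R (F1 * F2)%type -> idealr_closed I -> nonzero_ideal I ->
  sdf_absorbing I.
Proof.
case=> f fbij idI nzI.
have [kerI|kerI] := product_ideal_kernel _ _ _ f I fbij idI nzI.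
- exact: (kernel_sdf_absorbing _ _ (fst \o f) I idI kerI).
- exact: (kernel_sdf_absorbing _ _ (snd \o f) I idI kerI).
Qed.

(** * Ideals of a field *)

Lemma field_ideal0 (R : comUnitRingType) (I : {pred R}) (x : R) :
  GRing.field_axiom R -> idealr_closed I -> x \in I -> x = 0.
Proof.
move=> fldR idI xI; apply/eqP; apply: contraT => /fldR Ux.
by have [_ /negP[]] := idI; rewrite -(divrr Ux); apply: ideal_mulr.
Qed.

Lemma field_sdf_absorbing (R : comUnitRingType) (I : {pred R}) :
  GRing.field_axiom R -> idealr_closed I -> sdf_absorbing I.
Proof.
move=> fldR idI; split=> // a b _ _ abI; have [I0 _ _] := idI.
have := field_ideal0 _ _ _ fldR idI abI; rewrite subr_sqr => ab0.
have [->|/fldR U] := eqVneq (a - b) 0; first by right.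
by left; rewrite -(mulKr U (a + b)) ab0 mulr0.
Qed.

Lemma not_field_nonunit (R : comUnitRingType) :
    ~ GRing.field_axiom R ->
  exists2 x : R, x != 0 & ~ (exists r, 1 = x * r).
Proof.
case/existsNP=> x /not_implyP[x0 nUx]; exists x => // -[r xr].
by apply: nUx; apply/unitrPr; exists r.
Qed.

Theorem theorem3p5 (R : comUnitRingType)
    (R_reduced : reduced_ring R) (unit2 : (2%:R : R) \is a GRing.unit) :
  ((forall I : {pred R}, idealr_closed I -> nonzero_ideal I -> sdf_absorbing I)
   <-> (GRing.field_axiom R \/
        exists F1 F2 : fieldType, ring_isomorphic R (F1 * F2)%type))
  /\
  ((forall I : {pred R}, idealr_closed I -> sdf_absorbing I)
   <-> GRing.field_axiom R).
Proof.
have primes :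
    (forall I : {pred R}, idealr_closed I -> nonzero_ideal I -> sdf_absorbing I) ->
  forall I : {pred R}, idealr_closed I -> nonzero_ideal I -> prime_idealr_closed I.
  by move=> sdf I idI nzI; apply: sdf_absorbing_prime => //; apply: sdf.
split; split.
- move=> /primes primeR; have [|/not_field_nonunit[x x0 nux]] :=
    pselect (GRing.field_axiom R); [by left | right].
  have [e [ee e0 e1]] := primes_idempotent R R_reduced primeR x x0 nux.
  exact: idempotent_product ee e0 e1 (corner_inverse R R_reduced primeR).
- move=> [fldR|[F1 [F2 isoR]]] I idI nzI; first exact: field_sdf_absorbing.
  exact: product_sdf_absorbing isoR idI nzI.
- move=> sdf; have [//|/not_field_nonunit[x x0 nux]] :=
    pselect (GRing.field_axiom R).
  have primeR := primes (fun I idI _ => sdf I idI).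
  have [e [ee e0 e1]] := primes_idempotent R R_reduced primeR x x0 nux.
  have id0 : idealr_closed (pred1 (0 : R)).
    split; rewrite ?inE ?oner_eq0 // => a u v.
    by rewrite !inE => /eqP-> /eqP->; rewrite mulr0 addr0.
  by have [/eqP|/eqP] := sdf0_idempotent R e unit2 (sdf _ id0) ee;
    rewrite ?(negPf e0) ?(negPf e1).
- by move=> fldR I; apply: field_sdf_absorbing.
Qed.
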